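(* Let $\mathcal{E}_{tr}$ be a finite set of environments and fix a representation $\Phi:\mathcal{X}\to\mathcal{Z}\subseteq\mathbb{R}^d$. Suppose the classifier class $\mathcal{H}_w$ consists of linear models $w(z)=\mathbf{w}^t z$ with $\mathbf{w}$ ranging over a closed, bounded, convex set $W\subseteq\mathbb{R}^d$ with non-empty interior, and suppose the loss $\ell(\mathbf{w}^t z,Y)$ (with $Y\in\mathbb{R}$) is convex and continuous in $\mathbf{w}$. Then a pure strategy Nash equilibrium of the ensemble game exists. Moreover, if at a Nash equilibrium $\{\mathbf{w}^q\}_{q\in\mathcal{E}_{tr}}$ every $\mathbf{w}^q$ lies in the interior of $W$, then the ensemble predictor $z\mapsto(\frac{1}{|\mathcal{E}_{tr}|}\sum_q\mathbf{w}^q)^t z$ composed with $\Phi$ is an invariant predictor among all linear models, i.e. $\bar{\mathbf{w}}=\frac{1}{|\mathcal{E}_{tr}|}\sum_q\mathbf{w}^q$ satisfies $R^e(\bar{\mathbf{w}}^t\Phi)\le R^e(\mathbf{v}^t\Phi)$ for all $\mathbf{v}\in\mathbb{R}^d$ and all $e\in\mathcal{E}_{tr}$.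
   Context: For each $e\in\mathcal{E}_{tr}$ there is a distribution of $(X^e,Y^e)$ with $X^e\in\mathcal{X}\subseteq\mathbb{R}^n$, $Y^e\in\mathbb{R}$; the risk of a predictor $f$ is $R^e(f)=\mathbb{E}[\ell(f(X^e),Y^e)]$. Ensemble game with representation $\Phi$: the players are the environments; player $e$ chooses $\mathbf{w}^e\in W$; its utility is $u_e=-R^e(w^{av}\circ\Phi)$ where $w^{av}(z)=(\frac{1}{|\mathcal{E}_{tr}|}\sum_q\mathbf{w}^q)^t z$. A pure Nash equilibrium is a profile from which no player can strictly increase its utility by unilaterally changing its own $\mathbf{w}^e$ within $W$. *)

(* Defs.v *)
From HB Require Import structures.
From mathcomp Require Import all_boot all_order all_algebra.
From mathcomp Require Import all_classical all_reals all_analysis.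
Set Implicit Arguments. Unset Strict Implicit. Unset Printing Implicit Defensive.
Import Order.TTheory GRing.Theory Num.Theory.
Import numFieldNormedType.Exports.
Local Open Scope classical_set_scope.
Local Open Scope ring_scope.

Definition dotv (R : realType) (d : nat) (w z : 'rV[R]_d) : R :=
  (w *m z^T) 0 0.

Definition risk (R : realType) (d0 : measure_display) (X : measurableType d0)
  (P : probability (X * R)%type R) (loss : R -> R -> R) (f : X -> R) : \bar R :=
  (\int[P]_xy (loss (f xy.1) xy.2)%:E)%E.

Definition wav (R : realType) (d : nat) (E : finType) (ws : E -> 'rV[R]_d)
  : 'rV[R]_d := (#|E|%:R)^-1 *: \sum_(q : E) ws q.

Definition upd (R : realType) (d : nat) (E : finType) (ws : E -> 'rV[R]_d)
  (e : E) (w' : 'rV[R]_d) : E -> 'rV[R]_d :=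
  fun q => if q == e then w' else ws q.

Definition linpred (R : realType) (d : nat) (X : Type) (Phi : X -> 'rV[R]_d)
  (w : 'rV[R]_d) : X -> R := fun x => dotv w (Phi x).

(* pure Nash equilibrium of the ensemble game: utility of e is
   u_e = - R^e(w^av o Phi); no player can strictly increase it by a
   unilateral deviation within W. *)
Definition ensemble_nash (R : realType) (d0 : measure_display)
  (X : measurableType d0) (d : nat) (E : finType)
  (P : E -> probability (X * R)%type R) (loss : R -> R -> R)
  (Phi : X -> 'rV[R]_d) (W : set 'rV[R]_d) (ws : E -> 'rV[R]_d) : Prop :=
  (forall e, W (ws e)) /\
  forall e (w' : 'rV[R]_d), W w' ->
    ~ (- risk (P e) loss (linpred Phi (wav (upd ws e w')))
        > - risk (P e) loss (linpred Phi (wav ws)))%E.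

(* Main.v *)
(* A combinatorial lemma of Scarf on finite sets carrying one linear order per
   coordinate replaces Sperner's lemma: a parity count of doors and rooms gives,
   on arbitrarily fine grids of the simplex, small colourful sets, whence by
   compactness a KKM theorem for continuous functions.

   Finite convex functions on R^d, such as the risks, are continuous.  For
   profiles p, q in W^E let gain q p be the total risk reduction obtained when
   each player e separately deviates from p to q e.  It is concave in q,
   continuous in p, and vanishes for q = p, so KKM makes any finite family of
   conditions gain q p <= 0 solvable, and compactness of W^E all of them
   together; such a p is a Nash equilibrium.

   When every player is interior, a small deviation moves the average in any
   direction, so the average is a local, hence global, minimizer of each convex
   risk. *)
Require Import Defs.
From HB Require Import structures.
From mathcomp Require Import all_boot all_order all_algebra zify lra.
Set Implicit Arguments. Unset Strict Implicit. Unset Printing Implicit Defensive.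

(** * Scarf's lemma *)

Section Scarf.
Variables (V I : finType) (rk : I -> V -> nat).
Hypothesis rk_inj : forall i, injective (rk i).

(* Dominant sets of size [#|I|] are rooms, those of size [#|I| - 1] are doors. *)
Definition dominant (U : {set V}) :=
  [forall y, [exists i, [forall x in U, rk i y <= rk i x]]].

Definition extensions (U : {set V}) :=
  [set x | (x \notin U) && dominant (x |: U)].

Lemma dominantP (U : {set V}) :
  reflect (forall y, exists i, {in U, forall x, rk i y <= rk i x}) (dominant U).
Proof.
apply: (iffP forallP) => h y; have := h y.
  by case/existsP=> i /forall_inP ?; exists i.
by case=> i ?; apply/existsP; exists i; apply/forall_inP.
Qed.

Lemma dominantS (U U' : {set V}) : U' \subset U -> dominant U -> dominant U'.
Proof.
move=> /subsetP sUU' /dominantP domU; apply/dominantP => y.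
by have [i hi] := domU y; exists i => x /sUU'; exact: hi.
Qed.

Lemma minimizers_ex (U : {set V}) (u : V) : u \in U ->
  exists m : I -> V,
    (forall i, m i \in U) /\ (forall i, {in U, forall x, rk i (m i) <= rk i x}).
Proof.
move=> uU; exists (fun i => [arg min_(x < u in U) rk i x]).
by split=> i; case: arg_minnP.
Qed.

(** Testing dominance on a point [x] of [U] itself yields an order [i] in which [x] is lowest, so
    that [x] is [m i]. *)
Lemma dominant_minimizers (U : {set V}) (m : I -> V) :
  (forall i, m i \in U) -> (forall i, {in U, forall x, rk i (m i) <= rk i x}) ->
  dominant U -> m @: setT = U.
Proof.
move=> mU mle /dominantP domU; apply/setP => x; apply/imsetP/idP.
  by case=> i _ ->.
move=> xU; have [i hi] := domU x; exists i; rewrite ?inE//.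
by apply: (@rk_inj i); apply/eqP; rewrite eqn_leq hi// mle.
Qed.

(* A dominant set of size [#|I| - 1] has exactly one index pair [a], [b] with a
   common minimizer, and dropping the constraint of [a] or of [b] gives at most
   one extension each. *)
Lemma card_extensions (U : {set V}) (m : I -> V) :
  #|U|.+1 = #|I| -> dominant U ->
  (forall i, m i \in U) -> (forall i, {in U, forall x, rk i (m i) <= rk i x}) ->
  (forall j, exists y, forall i, i != j -> rk i (m i) < rk i y) ->
  #|extensions U| = 2.
Proof.
move=> cU domU mU mle Mne.
have imU := dominant_minimizers mU mle domU.
have [a [b [ab mab]]] : exists a b, a != b /\ m a = m b.
  have : ~~ injectiveb m.
    apply/negP => /injectiveP minj.
    by move: (card_imset setT minj); rewrite imU cardsT -cU => /eqP; rewrite eqn_leq ltnn andbF.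
  by move/injectivePn => [a [b ab mab]]; exists a, b.
have injC i j : i != j -> m i = m j -> {in ~: [set i] &, injective m}.
  move=> ij mij; apply/imset_injP.
  have -> : m @: (~: [set i]) = U.
    apply/eqP; rewrite eqEsubset; apply/andP; split.
      by apply/subsetP => x /imsetP[k _ ->].
    apply/subsetP => x; rewrite -imU => /imsetP[k _ ->].
    have [->|ki] := eqVneq k i; last by apply: imset_f; rewrite !inE.
    by rewrite mij; apply: imset_f; rewrite !inE eq_sym.
  by rewrite cardsC1 -cU.
have pairC j : {in ~: [set j] &, injective m} -> (j == a) || (j == b).
  move=> jinj; apply/negPn; rewrite negb_or; apply/negP => /andP[ja jb].
  by move: ab; rewrite (jinj a b) ?eqxx// !inE eq_sym.
(* The candidate obtained by dropping constraint [j]: among the points strictly above all the other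
   minimizers, the highest in order [j]. *)
have ex_max j : exists x, [/\ forall i, i != j -> rk i (m i) < rk i x &
    forall y, (forall i, i != j -> rk i (m i) < rk i y) -> rk j y <= rk j x].
  have [y0 hy0] := Mne j.
  have py0 : [pred y | [forall i, (i != j) ==> (rk i (m i) < rk i y)]] y0.
    by apply/forallP => i; apply/implyP/hy0.
  case: (arg_maxnP (rk j) py0) => x /forallP hx xmax; exists x; split.
    by move=> i; apply/implyP.
  by move=> y hy; apply: xmax; apply/forallP => i; apply/implyP/hy.
have out j k x : j != k -> m j = m k ->
    (forall i, i != j -> rk i (m i) < rk i x) -> x \notin U.
  move=> jk mjk hx; apply/negP => xU.
  move: (xU); rewrite -imU => /imsetP[i _ xi].
  have [ij|ij] := eqVneq i j; last by have := hx _ ij; rewrite -xi ltnn.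
  by have := hx k; rewrite -mjk -ij -xi ltnn eq_sym ij jk => /(_ isT).
have lowj x j : (forall i, i != j -> rk i (m i) < rk i x) ->
    {in U, forall z, rk j x <= rk j z}.
  move=> hx; have /dominantP/(_ x)[i hi] := domU.
  have [<-//|ij] := eqVneq i j.
  by have := leq_trans (hx i ij) (hi _ (mU i)); rewrite ltnn.
have domx j x : (forall i, i != j -> rk i (m i) < rk i x) ->
    (forall y, (forall i, i != j -> rk i (m i) < rk i y) -> rk j y <= rk j x) ->
    dominant (x |: U).
  move=> hx xmax; apply/dominantP => y.
  have [/forallP hy|] := boolP [forall i, (i != j) ==> (rk i (m i) < rk i y)].
    have {}hy i : i != j -> rk i (m i) < rk i y by apply/implyP.
    exists j => z; rewrite !inE => /orP[/eqP->|]; first exact: xmax.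
    exact: lowj.
  rewrite negb_forall => /existsP[i]; rewrite negb_imply -leqNgt => /andP[ij yi].
  exists i => z; rewrite !inE => /orP[/eqP->|zU].
    by apply: (leq_trans yi); apply/ltnW/hx.
  exact: leq_trans yi (mle _ _ zU).
have [xa [hxa xamax]] := ex_max a; have [xb [hxb xbmax]] := ex_max b.
have xab : xa != xb.
  apply/eqP => e; have := hxa b; rewrite eq_sym => /(_ ab).
  by rewrite ltnNge e (lowj xb b hxb).
suff -> : extensions U = [set xa; xb] by rewrite cards2 xab.
apply/setP => x; rewrite !inE; apply/andP/orP; last first.
  case=> /eqP->; split.
  - exact: (out a b).
  - exact: (domx a).
  - by apply: (out b a) => //; rewrite eq_sym.
  - exact: (domx b).
case=> xU domxU.
(* Conversely, the minimizers of [x |: U] are distinct. So [x] is the minimizer of a single order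
   [j], the others are those of [U], and [m] is injective off [j], which leaves [j = a] or
   [j = b]. *)
have [m' [m'U m'le]] := minimizers_ex (setU11 x U).
have imU' := dominant_minimizers m'U m'le domxU.
have m'inj : injective m'.
  have /imset_injP m'inj : #|m' @: setT| == #|[set: I]|.
    by rewrite imU' cardsU1 xU cardsT -cU.
  by move=> i k; apply: m'inj; rewrite inE.
have [j _ xj] : exists2 j, j \in setT & x = m' j.
  by apply/imsetP; rewrite imU' setU11.
have m'E i : i != j -> m' i = m i.
  move=> ij; apply: (@rk_inj i); apply/eqP; rewrite eqn_leq.
  rewrite m'le ?inE ?mU ?orbT// mle//.
  by have := m'U i; rewrite !inE xj (inj_eq m'inj) (negPf ij).
have hx i : i != j -> rk i (m i) < rk i x.
  move=> ij; rewrite ltn_neqAle -m'E// m'le ?setU11// andbT.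
  by rewrite (inj_eq (@rk_inj i)) xj (inj_eq m'inj).
have xmax y : (forall i, i != j -> rk i (m i) < rk i y) -> rk j y <= rk j x.
  move=> hy; have /dominantP/(_ y)[i hi] := domxU.
  have [<-|ij] := eqVneq i j; first by apply: hi; rewrite setU11.
  have := leq_trans (hy i ij) (hi (m i) _).
  by rewrite !inE mU orbT ltnn => /(_ isT).
have uniq z : (forall i, i != j -> rk i (m i) < rk i z) ->
    (forall y, (forall i, i != j -> rk i (m i) < rk i y) -> rk j y <= rk j z) ->
    x = z.
  by move=> hz zmax; apply: (@rk_inj j); apply/eqP; rewrite eqn_leq zmax// xmax.
have /pairC/orP[/eqP ja|/eqP jb] : {in ~: [set j] &, injective m}.
  by move=> i k; rewrite !inE => ij kj; rewrite -!m'E// => /m'inj.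
- by left; apply/eqP; apply: uniq; rewrite ja.
- by right; apply/eqP; apply: uniq; rewrite jb.
Qed.

(* [s i] are the slack vertices, lowest in order [i] and highest in the others;
   they turn all doors but one per index into two-sided ones. *)
Variables (s : I -> V) (c : V -> I) (y0 : V).
Hypothesis s_min : forall i y, y != s i -> rk i (s i) < rk i y.
Hypothesis s_max : forall i j y, i != j -> y \notin codom s -> rk i y < rk i (s j).
Hypothesis y0s : y0 \notin codom s.
Hypothesis cs : forall i, c (s i) = i.

Let s_inj : injective s := can_inj cs.

(** The extension is the non-slack vertex highest in order [i]. Adding [s i] instead would break
    dominance at [y0], which lies above some slack in every order. *)
Lemma card_extensions_slack i : #|extensions (s @: (~: [set i]))| = 1.
Proof.
case: (@arg_maxnP _ y0 (fun y => y \notin codom s) (rk i) y0s) => x xs xmax.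
suff -> : extensions (s @: (~: [set i])) = [set x] by rewrite cards1.
have ns z : z \notin codom s -> z \notin s @: (~: [set i]).
  by apply: contra => /imsetP[k _ ->]; apply: codom_f.
apply/setP => z; rewrite !inE; apply/andP/eqP => [[zU /dominantP domz]|->].
  have below y : y \notin codom s -> rk i y <= rk i z.
    move=> ys; have [j hj] := domz y.
    have [<-|ji] := eqVneq j i; first by apply: hj; rewrite setU11.
    have : rk j y <= rk j (s j) by apply: hj; rewrite inE imset_f ?orbT// !inE.
    rewrite leqNgt s_min//; apply: contraNneq ys => ->; exact: codom_f.
  have zs : z \notin codom s.
    apply/negP => /codomP[k zk]; move: zU; rewrite zk (mem_imset _ _ s_inj) !inE negbK => /eqP ki.
    have := below _ y0s; rewrite zk ki leqNgt s_min//.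
    by apply: contraNneq y0s => ->; apply: codom_f.
  by apply: (@rk_inj i); apply/eqP; rewrite eqn_leq below// andbT; apply: xmax.
split; first exact: ns.
apply/dominantP => y; have [/codomP[k ->]|ys] := boolP (y \in codom s).
  exists k => t _; have [->//|tk] := eqVneq t (s k); exact/ltnW/s_min.
exists i => t; rewrite !inE => /orP[/eqP->|/imsetP[k]]; first exact: xmax.
by rewrite !inE => ki ->; apply/ltnW/s_max => //; rewrite eq_sym.
Qed.

(** The point [s j] serves as the strict upper point in [card_extensions]. If it fails in order [i],
    all of [U] lies at or above [s j] there, hence consists of slacks other than [s i], and by
    cardinality of all of these. *)
Lemma card_extensions_nonslack (U : {set V}) :
  U != set0 -> #|U|.+1 = #|I| -> dominant U ->
  (forall i, U <> s @: (~: [set i])) -> #|extensions U| = 2.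
Proof.
move=> /set0Pn[u uU] cU domU nslack.
have [m [mU mle]] := minimizers_ex uU.
apply: (card_extensions cU domU mU mle) => j; exists (s j) => i ij.
rewrite ltnNge; apply/negP => le_sj; apply: (nslack i).
apply/eqP; rewrite eqEcard card_imset// cardsC1 -cU leqnn andbT.
apply/subsetP => x xU.
have lex : rk i (s j) <= rk i x := leq_trans le_sj (mle _ _ xU).
have : x \in codom s.
  by apply/negPn/negP => /(s_max ij); rewrite ltnNge lex.
case/codomP => k xk; rewrite xk imset_f// !inE; apply/eqP => ki.
by move: lex; rewrite xk ki leqNgt s_min// (inj_eq s_inj) eq_sym.
Qed.

(** Among the doors carrying all colours but [i0], only the slack door without [s i0] has a single
    extension; each other one contributes 2. *)
Lemma odd_doors i0 :
  odd (\sum_(U : {set V} | [&& #|U|.+1 == #|I|, dominant U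
                             & c @: U == ~: [set i0]]) #|extensions U|).
Proof.
set S := s @: (~: [set i0]).
have cS : c @: S = ~: [set i0].
  by rewrite /S -imset_comp (eq_imset (g := id)) ?imset_id// => k /=; rewrite cs.
have cardS : #|S|.+1 = #|I|.
  by rewrite card_imset// cardsC1 prednK//; apply/card_gt0P; exists i0.
have domS : dominant S.
  have /card_gt0P[x] : 0 < #|extensions S| by rewrite card_extensions_slack.
  by rewrite inE => /andP[_]; apply: dominantS; rewrite subsetUr.
rewrite (bigD1 S) /=; last by rewrite cardS domS cS !eqxx.
rewrite card_extensions_slack oddD /=.
rewrite (eq_bigr (fun=> 2)) ?sum_nat_const ?oddM ?andbF//.
move=> U /andP[/and3P[/eqP cU domU /eqP colU] US].
apply: card_extensions_nonslack => //.
  apply: contraNneq US => U0; move: colU; rewrite U0 imset0 => e.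
  by rewrite /S -e imset0.
move=> i Ui; move: US; rewrite Ui.
suff -> : i = i0 by rewrite eqxx.
have : ~: [set i] = ~: [set i0].
  rewrite -colU Ui -imset_comp (eq_imset (g := id)) ?imset_id// => k /=; by rewrite cs.
by move/setC_inj/set1_inj.
Qed.

(** If removing [x] leaves every colour but [i0], each occurs once in the rest, and [x] repeats the
    colour of exactly one [x']. The only such removals are then those of [x] and [x']. *)
Lemma even_room i0 (Z : {set V}) : #|Z| = #|I| -> c @: Z != setT ->
  ~~ odd #|[set x in Z | c @: (Z :\ x) == ~: [set i0]]|.
Proof.
move=> cZ colZ; set A := [set x in Z | _].
have [->|/set0Pn[x]] := eqVneq A set0; first by rewrite cards0.
rewrite inE => /andP[xZ /eqP cx].
have cinj : {in Z :\ x &, injective c}.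
  by apply/imset_injP; rewrite cx cardsC1 -cZ (cardsD1 x Z) xZ.
have cxi0 : c x != i0.
  apply: contraNneq colZ => e; rewrite -(setD1K xZ) imsetU1 cx e.
  by rewrite setUCr.
have : c x \in c @: (Z :\ x) by rewrite cx !inE.
case/imsetP => x' x'Z cxx'.
suff -> : A = [set x; x'].
  by rewrite cards2; move: x'Z; rewrite !inE eq_sym => /andP[->].
apply/setP => z; rewrite !inE; apply/andP/orP => [[zZ /eqP cz]|].
  have [->|zx] := eqVneq z x; [by left|right].
  have zZx : z \in Z :\ x by rewrite !inE zx.
  have : c z \in c @: (Z :\ z) by rewrite cz -cx imset_f.
  case/imsetP => z' z'Z czz'.
  have [z'x|z'x] := eqVneq z' x.
    by apply/eqP/cinj => //; rewrite czz' z'x.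
  move: z'Z; rewrite !inE => /andP[z'z z'Z].
  by move: z'z; rewrite (cinj z z')// ?eqxx// !inE z'x.
case=> /eqP->; first by rewrite xZ cx.
move: (x'Z); rewrite !inE => /andP[x'x ->]; split=> //.
rewrite -cx eqEsubset; apply/andP; split; apply/subsetP => _ /imsetP[t + ->].
- rewrite !inE => /andP[tx' tZ]; have [->|tx] := eqVneq t x.
    by rewrite cxx' imset_f.
  by rewrite imset_f// !inE tx.
- rewrite !inE => /andP[tx tZ]; have [->|tx'] := eqVneq t x'.
    by rewrite -cxx' imset_f// !inE xZ eq_sym x'x.
  by rewrite imset_f// !inE tx'.
Qed.

Lemma colorful_dominant_ex : exists2 U, dominant U & c @: U = setT.
Proof.
pose i0 := c y0.
have := odd_doors i0; set S := bigop.body _ _ _.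
suff [//|odd0] : (exists2 U, dominant U & c @: U = setT) \/ ~~ odd S.
  by rewrite (negPf odd0).
have [/existsP[U /andP[? /eqP ?]]|] :=
  boolP [exists U, dominant U && (c @: U == setT)]; first by left; exists U.
rewrite negb_exists => /forallP nocol; right.
(* The pairs of a door [U] and an extension [x] are counted by the room [Z = x |: U] instead. *)
have -> : S = \sum_(Z : {set V} | (#|Z| == #|I|) && dominant Z)
    #|[set x in Z | c @: (Z :\ x) == ~: [set i0]]|.
  rewrite /S.
  under eq_bigr => U _ do rewrite -sum1_card.
  under [RHS]eq_bigr => Z _ do rewrite -sum1_card.
  rewrite !pair_big_dep /=.
  rewrite (reindex_onto (fun p : {set V} * V => (p.1 :\ p.2, p.2))
                        (fun p : {set V} * V => (p.2 |: p.1, p.2))) /=; last first.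
    by case=> U x /=; rewrite inE => /andP[_ /andP[xU _]]; rewrite setU1K.
  apply: eq_bigl => -[Z x] /=; rewrite !inE eqxx /=.
  have [xZ|xZ] := boolP (x \in Z); last first.
    rewrite !andbF; apply/negP => /andP[_ /eqP[e]].
    by move: xZ; rewrite -e setU11.
  rewrite setD1K// eqxx !andbT (cardsD1 x Z) xZ add1n.
  have [domZ|] := boolP (dominant Z); last by rewrite !andbF.
  by rewrite (dominantS (subsetDl _ _) domZ) !andbT.
apply/negP; elim/big_rec: _ => // Z n /andP[/eqP cZ domZ] hn.
rewrite oddD => /addbP; case: (odd n) hn => // _.
have := nocol Z; rewrite domZ /= => /(even_room i0 cZ)/negPf -> //.
Qed.
End Scarf.

(** Slack vertices are adjoined to [T]. The set [C] collects the indices whose slack is absent from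
    the colourful set, so that their colours come from points of [T]. *)
Lemma scarf (T I : finType) (v : I -> T -> nat) (col : T -> I) (t0 : T) :
  exists (C : {set I}) (x : I -> T),
    {in C, forall i, col (x i) = i} /\
    forall y, exists2 i, i \in C & {in C, forall j, v i y <= v i (x j)}.
Proof.
pose B := (\max_i \max_t v i t).+1 * #|T|.
(* The factor [#|T|] leaves space to break ties by [enum_rank]. The bound [B] puts a slack last in
   the orders of other indices, and the successors reserve rank 0 for its own order. *)
pose rk i (z : T + I) := match z with
  | inl t => (v i t * #|T| + enum_rank t).+1
  | inr j => if j == i then 0 else (B + enum_rank j).+1 end.
have rkB i t : v i t * #|T| + enum_rank t < B.
  apply: (@leq_trans ((v i t).+1 * #|T|)).
    by rewrite mulSn addnC ltn_add2r ltn_ord.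
  rewrite leq_mul2r ltnS; apply/orP; right.
  by apply: leq_trans (leq_bigmax i); exact: (leq_bigmax (F := v i)).
have rkv i t t' : v i t < v i t' -> rk i (inl t) < rk i (inl t').
  move=> lt; rewrite /rk ltnS -addnS; apply: leq_trans (leq_addr _ _).
  apply: leq_trans (leq_mul lt (leqnn _)).
  by rewrite mulSn addnC leq_add2r ltn_ord.
have rk_inj i : injective (rk i).
  case=> [t|j] [t'|j'] /=.
  - have [lt|lt|e] := ltngtP (v i t) (v i t').
    + by move=> e; have := rkv _ _ _ lt; rewrite [X in X < _]e ltnn.
    + by move=> e; have := rkv _ _ _ lt; rewrite [X in _ < X]e ltnn.
    + by rewrite e => /eq_add_S/addnI/val_inj/enum_rank_inj->.
  - by case: eqP => // _ /eq_add_S e; have := rkB i t; rewrite e ltnNge leq_addr.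
  - by case: eqP => // _ /eq_add_S e; have := rkB i t'; rewrite -e ltnNge leq_addr.
  - case: eqP => [->|_]; case: eqP => [->|_] //.
    by move=> /eq_add_S/addnI/val_inj/enum_rank_inj->.
pose c (z : T + I) := match z with inl t => col t | inr i => i end.
have ns (z : T + I) : z \notin codom inr -> exists t, z = inl t.
  by case: z => [t|j]; [exists t | rewrite codom_f].
have [] := @colorful_dominant_ex _ _ rk rk_inj inr c (inl t0) => //.
- move=> i [t|j] /=; rewrite eqxx// => ij; case: eqP => // e.
  by rewrite e eqxx in ij.
- move=> i j y ij /ns[t ->] /=; rewrite eq_sym (negPf ij) ltnS.
  exact: leq_trans (rkB i t) (leq_addr _ _).
- by apply/codomP => -[].
move=> U /dominantP domU colU.
pose C := [set i | inr i \notin U].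
have xex i : exists t, i \in C -> inl t \in U /\ col t = i.
  have [iC|] := boolP (i \in C); last by exists t0.
  have : i \in c @: U by rewrite colU inE.
  case/imsetP => -[t|j] zU /= ij; first by exists t.
  by move: iC; rewrite inE ij zU.
have /fin_all_exists[x xP] := xex.
exists C, x; split=> [i /xP[]//|y].
(* With rank 0 in order [i], the slack [inr i] cannot lie above [inl y]; so it is not in [U], and
   [i] is in [C]. *)
have [i hi] := domU (inl y); exists i.
  by rewrite inE; apply/negP => /hi; rewrite /= eqxx.
move=> j /xP[xU _]; rewrite leqNgt; apply/negP => /rkv.
by rewrite ltnNge hi.
Qed.

(** Scarf's lemma with the coordinates as values: all [x j] with [j] in [C] lie near the corner
    [mu], extended by 0 outside [C]. An index outside [C] thus has a small coordinate, an index in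
    [C] a nearby point of its colour. *)
Lemma scarf_grid (m K : nat) (col : {ffun 'I_m.+1 -> 'I_K.+1} -> 'I_m.+1) :
  exists (t0 : {ffun 'I_m.+1 -> 'I_K.+1}),
    \sum_i t0 i = K /\
    forall i, t0 i <= m.+1 \/
      exists t : {ffun 'I_m.+1 -> 'I_K.+1},
        [/\ \sum_i t i = K, col t = i & forall j, t j <= t0 j + m.+1 /\ t0 j <= t j + m.+1].
Proof.
pose T := {t : {ffun 'I_m.+1 -> 'I_K.+1} | \sum_i (t i : nat) == K}.
have mkT (f : 'I_m.+1 -> nat) : \sum_i f i = K -> exists t : T, forall i, val t i = f i :> nat.
  move=> fK; have hf i : f i < K.+1.
    by rewrite ltnS -fK (bigD1 i)//= leq_addr.
  have h : \sum_i (([ffun i => Ordinal (hf i)] : {ffun 'I_m.+1 -> 'I_K.+1}) i : nat) == K.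
    by apply/eqP; rewrite -[RHS]fK; apply: eq_bigr => i _; rewrite ffunE.
  by exists (Sub [ffun i => Ordinal (hf i)] h : T) => i; rewrite SubK ffunE.
have sT (t : T) : \sum_i (val t i : nat) = K by apply/eqP/(valP t).
have [t00 _] : exists t : T, true.
  have [|t _] := mkT (fun i => if i == ord0 then K else 0); last by exists t.
  by rewrite -big_mkcond big_pred1_eq.
have [C [x [colx domx]]] :=
  @scarf T 'I_m.+1 (fun i t => val t i) (col \o val) t00.
have [i0 i0C _] := domx t00.
pose mu i := val (x [arg min_(j < i0 in C) (val (x j) i : nat)]) i : nat.
have mule i j : j \in C -> mu i <= val (x j) i.
  by move=> jC; rewrite /mu; case: arg_minnP => // k kC; apply.
have muex i : exists2 j, j \in C & mu i = val (x j) i.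
  by rewrite /mu; case: arg_minnP => // k kC _; exists k.
(* Otherwise a grid point could exceed [mu] strictly in every coordinate of [C]. *)
have tight : K < \sum_(i in C) (mu i).+1.
  rewrite ltnNge; apply/negP => le.
  have [|y hy] := mkT (fun i => (if i \in C then (mu i).+1 else 0) +
     (if i == i0 then K - \sum_(i in C) (mu i).+1 else 0)).
    by rewrite big_split /= -!big_mkcond big_pred1_eq /= subnKC.
  have [i iC hi] := domx y; have [j jC e] := muex i.
  by have := hi _ jC; rewrite -e hy iC; lia.
have cardC : #|C| <= m.+1 by rewrite -[leqRHS]card_ord max_card.
have sum1 : \sum_(i in C) (mu i).+1 = \sum_(i in C) mu i + #|C|.
  by under eq_bigr do rewrite -addn1; rewrite big_split /= sum1_card.
(* The other coordinates already take their share of [mu], so by [tight] the excess in coordinate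
   [i] is below [#|C|]. *)
have up j : j \in C -> forall i, val (x j) i <= (if i \in C then mu i else 0) + m.+1.
  move=> jC i; have := sT (x j); rewrite (bigD1 i)//=.
  have : \sum_(k | k != i) (if k \in C then mu k else 0) <= \sum_(k | k != i) val (x j) k.
    by apply: leq_sum => k _; case: ifP => // _; apply: mule.
  have : \sum_(k in C) mu k = (if i \in C then mu i else 0) + 
      \sum_(k | k != i) (if k \in C then mu k else 0).
    by rewrite big_mkcond (bigD1 i).
  move: tight cardC; rewrite sum1.
  set a := \sum_(k in C) _; set b := if _ then _ else _.
  set s1 := \sum_(k | _) _; set s2 := \sum_(k | _) _.
  by move=> ? ? ? ? ?; lia.
have low j : j \in C -> forall i, (if i \in C then mu i else 0) <= val (x j) i.
  by move=> jC i; case: ifP => // _; apply: mule.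
exists (val (x i0)); split=> [|i]; first exact: sT.
have [iC|iC] := boolP (i \in C); last first.
  by left; have := up _ i0C i; rewrite (negPf iC).
right; exists (val (x i)); split; [exact: sT|exact: colx|move=> j].
by split; [apply: leq_trans (up _ iC j) _|apply: leq_trans (up _ i0C j) _];
  rewrite leq_add2r low.
Qed.

From mathcomp Require Import all_classical all_reals all_analysis.
Import Order.TTheory GRing.Theory Num.Theory.
Import numFieldNormedType.Exports.
Local Open Scope classical_set_scope.
Local Open Scope ring_scope.

(** * The KKM theorem *)

(** The sets containing a finite intersection within [A] form a proper filter, whose cluster point
    in [A] lies in each closed [f i]. *)
Lemma compact_finI (T : topologicalType) (A : set T) (I : choiceType)
    (f : I -> set T) : compact A -> (forall i, closed (f i)) ->
  (forall s : seq I, exists x, A x /\ {in s, forall i, f i x}) ->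
  exists x, A x /\ forall i, f i x.
Proof.
move=> cA cf fin.
pose F : set_system T :=
  [set B | exists s : seq I, forall x, A x -> {in s, forall i, f i x} -> B x].
have FF : ProperFilter F.
  apply: Build_ProperFilter_ex.
    by move=> B [s hs]; have [x [Ax fx]] := fin s; exists x; apply: hs.
  split; first by exists [::].
  - move=> B C [s hs] [s' hs']; exists (s ++ s') => x Ax fx; split.
      by apply: hs => // i si; apply: fx; rewrite mem_cat si.
    by apply: hs' => // i si; apply: fx; rewrite mem_cat si orbT.
  - by move=> B C BC [s hs]; exists s => x Ax fx; apply/BC/hs.
have [|p [Ap clp]] := cA F FF; first by exists [::].
exists p; split=> // i; apply: cf => B Bp; apply: clp Bp.
by exists [:: i] => x _; apply; rewrite inE.
Qed.

Lemma continuous_sum (K : numFieldType) (V : normedModType K)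
    (T : topologicalType) (I : finType) (F : I -> T -> V) :
  (forall i, continuous (F i)) -> continuous (fun x => \sum_i F i x).
Proof.
by move=> Fc; apply: continuous_big => //; apply: add_continuous.
Qed.

Definition simplex (R : realType) (m : nat) : set 'rV[R]_m :=
  [set x | (forall i, 0 <= x ord0 i) /\ \sum_i x ord0 i = 1].
Arguments simplex {R m}.

Lemma simplex_compact (R : realType) (m : nat) : compact (@simplex R m).
Proof.
apply: (@subclosed_compact _ _ [set v : 'rV[R]_m | forall i, `[0, 1]%classic (v ord0 i)]).
- rewrite (_ : simplex = \bigcap_i [set x : 'rV[R]_m | 0 <= x ord0 i] `&`
      [set x : 'rV[R]_m | \sum_i x ord0 i = 1]); last first.
    apply/seteqP; split=> x [h ?]; split=> //; first by move=> i _; apply: h.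
    by move=> i; apply: h.
  apply: closedI.
    apply: closed_bigI => i _.
    apply: (@preimage_closed _ _ (fun x : 'rV[R]_m => x ord0 i) [set r : R | 0 <= r]) => //.
      by move=> x _; apply: coord_continuous.
  apply: (@preimage_closed _ _ (fun x : 'rV[R]_m => \sum_i x ord0 i) [set r : R | r = 1]) => //.
    by move=> x _; apply: (continuous_sum (F := fun i (x : 'rV[R]_m) => x ord0 i)) => i; apply: coord_continuous.
- by apply: (@rV_compact R m (fun=> `[0, 1]%classic)) => _; apply: segment_compact.
- move=> x [x0 x1] i /=; rewrite in_itv /= x0 /= -x1 (bigD1 i) //= lerDl.
  exact: sumr_ge0.
Qed.

(** Grid points of mesh [1 / K] are coloured by an index [i] with [P i]; the discrepancy [m.+1] of
    [scarf_grid] becomes [m.+1 / K], at most [e]. *)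
Lemma simplex_labelling (R : realType) (m : nat)
    (P : 'I_m.+1 -> 'rV[R]_m.+1 -> Prop) (e : R) : 0 < e ->
  (forall x, simplex x -> exists i, P i x) ->
  exists2 z, simplex z & forall i, z ord0 i <= e \/
    exists2 y, P i y & forall j, `|z ord0 j - y ord0 j| <= e.
Proof.
move=> e0 cover.
pose K := (Num.bound (m.+1%:R / e)).+1.
have K0 : 0 < K%:R :> R by rewrite ltr0n.
have mK : m.+1%:R / K%:R <= e.
  rewrite ler_pdivrMr// mulrC -ler_pdivrMr//.
  apply: le_trans (ltW (archi_boundP _)) _; first by rewrite divr_ge0// ltW.
  by rewrite ler_nat.
pose pt (t : {ffun 'I_m.+1 -> 'I_K.+1}) : 'rV[R]_m.+1 :=
  \row_i ((t i : nat)%:R / K%:R).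
have ptS (t : {ffun 'I_m.+1 -> 'I_K.+1}) : (\sum_i t i)%N = K -> simplex (pt t).
  move=> tK; split=> [i|]; first by rewrite mxE divr_ge0.
  under eq_bigr do rewrite mxE.
  by rewrite -mulr_suml -natr_sum tK divff// gt_eqF.
have /fin_all_exists[col hcol] (t : {ffun 'I_m.+1 -> 'I_K.+1}) :
    exists i, (\sum_i t i)%N = K -> P i (pt t).
  have [/ptS/cover[i Pi]|tK] := pselect ((\sum_i t i)%N = K); first by exists i.
  by exists ord0.
have [t0 [t0K ht0]] := scarf_grid col.
exists (pt t0); first exact: ptS.
move=> i; have [le|[t [tK <- tt0]]] := ht0 i; [left|right].
  by rewrite mxE; apply: le_trans _ mK; rewrite ler_pM2r ?invr_gt0// ler_nat.
exists (pt t); first exact: hcol.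
move=> j; rewrite !mxE -mulrBl normrM [X in _ * X]ger0_norm ?invr_ge0 ?(ltW K0)//.
apply: le_trans _ mK; rewrite ler_pM2r ?invr_gt0//.
have [] := tt0 j; rewrite -!(ler_nat R) !natrD ler_norml => h1 h2.
by apply/andP; split; lra.
Qed.

(* Dual KKM covering: the [i]-th closed set contains the facet [x_i = 0]. *)
Lemma simplex_common_zero (R : realType) (m : nat) (h : 'I_m.+1 -> 'rV[R]_m.+1 -> R) :
  (forall i, continuous (h i)) ->
  (forall i (x : 'rV[R]_m.+1), x ord0 i = 0 -> h i x <= 0) ->
  (forall x, simplex x -> exists i, h i x <= 0) ->
  exists2 x, simplex x & forall i, h i x <= 0.
Proof.
move=> hc h0 cover.
have /choice[z hz] : forall n : nat, exists z : 'rV[R]_m.+1, simplex z /\ forall i,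
    exists2 y, h i y <= 0 & forall j, `|z ord0 j - y ord0 j| <= n.+1%:R^-1.
  move=> n; have n0 : 0 < n.+1%:R^-1 :> R by rewrite invr_gt0 ltr0n.
  have [z zS zP] := simplex_labelling n0 cover.
  exists z; split=> // i; have [zi|//] := zP i.
  (* Replacing a small coordinate [i] by 0 lands on the hyperplane where [h i] is nonpositive, so
     both alternatives give a nearby point of this kind. *)
  exists (\row_j (if j == i then 0 else z ord0 j)).
    by apply: h0; rewrite mxE eqxx.
  move=> j; rewrite mxE; case: eqP => [->|_]; last by rewrite subrr normr0 ltW.
  by rewrite subr0 ger0_norm//; case: zS.
have [|x [xS clx]] := @simplex_compact R m.+1 (z @ \oo) _.
  by exists 0%N => // n _; have [] := hz n.
exists x => // i; rewrite leNgt; apply/negP => hx.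
have : \forall y \near x, 0 < h i y.
  exact: (hc i x _ (lt_nbhsr hx)).
move=> /nbhs_ballP[e /= e0 he].
pose E := PosNum (divr_gt0 e0 (ltr0n R 2)).
have zE : (z @ \oo) [set z n | n in [set n | n.+1%:R^-1 < E%:num]].
  by have := near_infty_natSinv_lt E; apply: filterS => n; exists n.
have xb : nbhs x (ball x (e / 2)) by apply: nbhsx_ballx; rewrite divr_gt0.
have [_ [[n nE <-] zn]] := clx _ _ zE xb.
have [_ /(_ i)[y hy zy]] := hz n.
have /he : ball x e y.
  rewrite [e]splitr; apply: ball_triangle zn _; split; first by rewrite divr_gt0.
  by move=> k j; rewrite ord1; apply: le_lt_trans (zy j) nE.
by rewrite /= ltNge hy.
Qed.

(** With [gp] the positive parts, the [h i] below sum to 0 on the simplex and are nonpositive where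
    [x_i = 0], hence are all nonpositive at some [x]. There an index with [x_i > 0] and [g i x <= 0]
    forces the sum of the [gp j x] to vanish. *)
Lemma simplex_kkm (R : realType) (m : nat) (g : 'I_m.+1 -> 'rV[R]_m.+1 -> R) :
  (forall i, continuous (g i)) ->
  (forall x : 'rV[R]_m.+1, simplex x -> exists2 i, 0 < x ord0 i & g i x <= 0) ->
  exists2 x, simplex x & forall i, g i x <= 0.
Proof.
move=> gc gneg.
pose gp i x := Num.max (g i x) 0.
have gp0 i x : 0 <= gp i x by rewrite le_max lexx orbT.
have gpc i : continuous (gp i).
  by move=> x; apply: continuous_max; [exact: gc|exact: cst_continuous].
pose h i (x : 'rV[R]_m.+1) := x ord0 i * (\sum_j gp j x) - gp i x.
have [|||x xS hx] := @simplex_common_zero R m h.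
- move=> i x; have cx : {for x, continuous (fun y : 'rV[R]_m.+1 => y ord0 i)}.
    exact: coord_continuous.
  exact: (continuousB (continuousM cx (continuous_sum gpc (x := x))) (gpc i x)).
- by move=> i x x0; rewrite /h x0 mul0r sub0r oppr_le0.
- move=> x [x0 x1]; apply: contrapT => nex.
  have : 0 < \sum_i h i x.
    rewrite (bigD1 ord0)//=; apply: ltr_pwDl.
      by rewrite ltNge; apply/negP => ?; apply: nex; exists ord0.
    apply: sumr_ge0 => i _; rewrite leNgt; apply/negP => /ltW ?; apply: nex.
    by exists i.
  by rewrite sumrB -mulr_suml x1 mul1r subrr ltxx.
exists x => // i0; have [x0 x1] := xS.
have [i xi gi] := gneg x xS.
have gpi : gp i x = 0 by apply/eqP; rewrite eq_le gp0 ge_max gi lexx.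
have s0 : \sum_j gp j x = 0.
  apply/eqP; rewrite eq_le sumr_ge0// andbT.
  by have := hx i; rewrite /h gpi subr0 pmulr_rle0.
have <- : gp i0 x = 0 by apply: (psumr_eq0P (fun j _ => gp0 j x) s0).
by rewrite le_max lexx.
Qed.

(** * Convex functions *)

Lemma convex_setP (R : numDomainType) (V : lmodType R) (A : set V) :
  convex_set A <-> forall x y t, 0 <= t -> t <= 1 -> A x -> A y ->
    A (t *: x + (1 - t) *: y).
Proof.
split=> [cA x y t t0 t1 Ax Ay|cA x y t].
  by have := cA x y (Itv01 t0 t1); rewrite !inE; apply.
by rewrite !inE => Ax Ay; apply: cA.
Qed.

Lemma convex_functionP (R : numFieldType) (V : lmodType R) (f : V -> R^o) :
  convex_function setT f <-> forall x y t, 0 <= t -> t <= 1 ->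
    f (t *: x + (1 - t) *: y) <= t * f x + (1 - t) * f y.
Proof.
split=> [cf x y t t0 t1|cf t x y _ _]; last exact: cf.
by apply: (cf (Itv01 t0 t1)); rewrite inE.
Qed.

(** The base point [x0] absorbs the missing weight, so the weights need only sum to at most 1, a
    condition that survives division by [1 - l i] in the induction. *)
Lemma convex_set_combination (R : realFieldType) (V : lmodType R) (A : set V)
    (I : eqType) (s : seq I) (l : I -> R) (x : I -> V) (x0 : V) :
  convex_set A -> A x0 -> (forall i, A (x i)) -> (forall i, 0 <= l i) ->
  \sum_(i <- s) l i <= 1 -> A (x0 + \sum_(i <- s) l i *: (x i - x0)).
Proof.
move=> /convex_setP cA Ax0 Ax.
elim: s l => [|i s ih] l l0; first by rewrite !big_nil addr0.
rewrite !big_cons => l1.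
have sl0 : 0 <= \sum_(j <- s) l j by apply: sumr_ge0.
have [li1|] := ltP (l i) 1; last first.
  move=> li1; have lE : l i = 1 by lra.
  have /eqP : \sum_(j <- s) l j = 0 by lra.
  rewrite psumr_eq0//.
  elim: s {ih l1 sl0} => [|j s ih] /=; first by rewrite big_nil addr0 lE scale1r addrC subrK.
  by case/andP => /eqP lj /ih; rewrite big_cons lj scale0r add0r.
have c0 : 0 < 1 - l i by rewrite subr_gt0.
have -> : x0 + (l i *: (x i - x0) + \sum_(j <- s) l j *: (x j - x0)) =
    l i *: x i + (1 - l i) *: (x0 + \sum_(j <- s) (l j / (1 - l i)) *: (x j - x0)).
  rewrite [in RHS]scalerDr scaler_sumr; under [in RHS]eq_bigr => j _ do
    rewrite scalerA mulrC divfK ?gt_eqF//.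
  rewrite scalerBr scalerBl scale1r !addrA; congr (_ + _).
  by rewrite [l i *: x i + x0]addrC.
apply: cA => //; first by rewrite ltW.
apply: ih => [j|]; first by rewrite divr_ge0// ltW.
by rewrite -mulr_suml ler_pdivrMr// mul1r; lra.
Qed.

(** Jensen's inequality, from [convex_set_combination] applied to the epigraph of [f]. *)
Lemma convex_function_combination (R : realFieldType) (V : lmodType R)
    (f : V -> R^o) (I : eqType) (s : seq I) (l : I -> R) (x : I -> V) (x0 : V) :
  convex_function setT f -> (forall i, 0 <= l i) -> \sum_(i <- s) l i <= 1 ->
  f (x0 + \sum_(i <- s) l i *: (x i - x0)) <=
    f x0 + \sum_(i <- s) l i * (f (x i) - f x0).
Proof.
move=> /convex_functionP cf l0 l1.
pose A := [set p : V * R^o | f p.1 <= p.2].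
have cA : convex_set A.
  apply/convex_setP => p q t t0 t1 Ap Aq; apply: le_trans (cf _ _ _ t0 t1) _.
  by apply: lerD; rewrite ler_wpM2l ?subr_ge0.
have := @convex_set_combination _ _ A _ s l (fun i => (x i, f (x i)))
  (x0, f x0) cA (lexx _) (fun i => lexx _) l0 l1.
rewrite /A /=.
by rewrite !(big_morph fst (fun _ _ => erefl) erefl)
  !(big_morph snd (fun _ _ => erefl) erefl).
Qed.

(** Jensen's inequality at [x] and the points [x + Num.sg (v 0 i) *: e_ i] bounds [f (x + v) - f x]
    above; convexity at the midpoint [x] of [x + v] and [x - v] turns this into a lower bound. *)
Lemma convex_function_continuous (R : realType) (d : nat)
    (f : 'rV[R]_d -> R^o) : convex_function setT f -> continuous f.
Proof.
move=> cf x.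
pose e_ i : 'rV[R]_d := delta_mx 0 i.
pose M i := `|f (x + e_ i) - f x| + `|f (x - e_ i) - f x|.
have M0 i : 0 <= M i by rewrite addr_ge0.
have sM0 : 0 <= \sum_i M i by apply: sumr_ge0.
have up (v : 'rV[R]_d) : \sum_i `|v 0 i| <= 1 ->
    f (x + v) - f x <= \sum_i `|v 0 i| * M i.
  move=> v1; have := @convex_function_combination _ _ f _ (index_enum 'I_d)
    (fun i => `|v 0 i|) (fun i => x + Num.sg (v 0 i) *: e_ i) x cf
    (fun i => normr_ge0 _) v1.
  have -> : \sum_i `|v 0 i| *: (x + Num.sg (v 0 i) *: e_ i - x) = v.
    rewrite [RHS]row_sum_delta; apply: eq_bigr => i _.
    by rewrite addrAC subrr add0r scalerA mulrC -numEsg.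
  rewrite -lerBlDl => le; apply: (le_trans le); apply: ler_sum => i _.
  apply: ler_wpM2l => //; rewrite /M.
  case: (sgrP (v 0 i)) => _; rewrite ?scale0r ?addr0 ?subrr ?scale1r ?scaleN1r.
  - exact: M0.
  - by apply: le_trans (ler_norm _) _; rewrite lerDl.
  - by apply: le_trans (ler_norm _) _; rewrite lerDr.
have lip (v : 'rV[R]_d) : \sum_i `|v 0 i| <= 1 ->
    `|f (x + v) - f x| <= \sum_i `|v 0 i| * M i.
  move=> v1; rewrite ler_norml up// andbT.
  have nN F : \sum_i `|(- v) 0 i| * F i = \sum_i `|v 0 i| * F i.
    by apply: eq_bigr => i _; rewrite mxE normrN.
  have := up (- v); rewrite nN.
  under [X in (X <= 1 -> _)]eq_bigr do rewrite mxE normrN.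
  move=> /(_ v1); have /convex_functionP/(_ (x + v) (x - v) 2^-1) := cf.
  have -> : 2^-1 *: (x + v) + (1 - 2^-1) *: (x - v) = x.
    have -> : 1 - 2^-1 = 2^-1 :> R by lra.
    by rewrite -scalerDr addrACA subrr addr0 scalerDr -scalerDl -[RHS]scale1r;
      congr (_ *: _); lra.
  have h0 : 0 <= 2^-1 :> R by lra.
  have h1 : 2^-1 <= 1 :> R by lra.
  by move=> /(_ h0 h1); set S := \sum_i _; lra.
apply/(@cvgrPdist_le _ _ _ (nbhs (x : 'rV[R]_d))) => eps eps0.
(* The first bound keeps the sum of the [|v_i|] at most 1, with [d.+1] nonzero even for [d = 0]; the
   second brings the estimate below [eps]. *)
pose r := Num.min (d.+1%:R^-1) (eps / (1 + \sum_i M i)).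
have r0 : 0 < r by rewrite lt_min invr_gt0 ltr0n divr_gt0// ltr_wpDr.
near=> y.
have yr i : `|(y - x) 0 i| <= r.
  have [_ /(_ 0 i)] : ball x r y by near: y; exact: nbhsx_ballx.
  by rewrite /ball /= !mxE distrC => /ltW.
have := lip (y - x); rewrite (addrC x) subrK (distrC (f y)).
move=> le; apply: (le_trans (le _)).
  apply: le_trans (ler_sum _ (fun i _ => yr i)) _.
  rewrite sumr_const card_ord -mulr_natr.
  apply: le_trans (ler_wpM2r _ (_ : r <= d.+1%:R^-1)) _ => //.
    by rewrite ge_min lexx.
  by rewrite mulrC ler_pdivrMr ?mul1r ?ler_nat ?ltr0n.
apply: le_trans (ler_sum _ (fun i _ => ler_wpM2r (M0 i) (yr i))) _.
rewrite -mulr_sumr; apply: le_trans (ler_wpM2r _ (_ : r <= eps / (1 + \sum_i M i))) _ => //.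
  by rewrite ge_min lexx orbT.
by rewrite mulrAC ler_pdivrMr ?ltr_wpDr// ler_wpM2l ?ltW// ltrDr.
Unshelve. all: by end_near. Qed.

(** * Games played through an average *)

Lemma wav_upd (R : realType) (d : nat) (E : finType) (ws : E -> 'rV[R]_d) e w :
  wav (upd ws e w) = wav ws + #|E|%:R^-1 *: (w - ws e).
Proof.
rewrite /wav -scalerDr; congr (_ *: _).
rewrite [in LHS](bigD1 e)//= [in RHS](bigD1 e)//= {1}/upd eqxx.
rewrite [ws e + _]addrC -addrA [ws e + _]addrC subrK [RHS]addrC; congr (_ + _).
by apply: eq_bigr => q /negPf qe; rewrite /upd qe.
Qed.

Lemma continuous_wav (R : realType) (d : nat) (E : finType) (T : topologicalType)
    (h : T -> E -> 'rV[R]_d) :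
  (forall e, continuous (h ^~ e)) -> continuous (fun t => wav (h t)).
Proof.
move=> hc x.
exact: (continuousZl_tmp (k := #|E|%:R^-1) (continuous_sum hc (x := x))).
Qed.

Section Nikaido_Isoda.
Variables (R : realType) (d : nat) (E : finType) (f : E -> 'rV[R]_d -> R).
Hypothesis f_convex : forall e, convex_function setT (f e : 'rV[R]_d -> R^o).
Implicit Types p q : E -> 'rV[R]_d.

(** The Nikaido-Isoda function for the costs [f e]. *)
Definition gain q p := \sum_e (f e (wav p) - f e (wav (upd p e (q e)))).

(** The parameter [h] covers both mixtures indexed by a simplex and the identity on the product
    space of profiles. *)
Lemma continuous_gain (T : topologicalType) q (h : T -> E -> 'rV[R]_d) :
  (forall e, continuous (h ^~ e)) -> continuous (fun t => gain q (h t)).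
Proof.
move=> hc; apply: (continuous_sum (V := R^o)
  (F := fun e t => f e (wav (h t)) - f e (wav (upd (h t) e (q e))))) => e x.
have fc := convex_function_continuous (f_convex e).
have hu : continuous (fun t => wav (upd (h t) e (q e))).
  apply: continuous_wav => e'; rewrite /upd; case: eqP => _; last exact: hc.
  by move=> ?; apply: cst_continuous.
have c1 : {for x, continuous (fun t => f e (wav (h t)))}.
  exact: (continuous_comp (continuous_wav hc (x := x)) (fc _)).
have c2 : {for x, continuous (fun t => f e (wav (upd (h t) e (q e))))}.
  exact: (continuous_comp (hu x) (fc _)).
exact: (continuousB c1 c2).
Qed.

(** The deviations [u i e] mix to [p e], so the averages after deviation mix to [wav p]; Jensen's
    inequality for each [f e] concludes. *)
Lemma gain_combination (I : finType) (l : I -> R) (u : I -> E -> 'rV[R]_d) :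
  (forall i, 0 <= l i) -> \sum_i l i = 1 ->
  \sum_i l i * gain (u i) (fun e => \sum_j l j *: u j e) <= 0.
Proof.
move=> l0 l1; set p := (fun e => \sum_j l j *: u j e).
rewrite /gain; under eq_bigr do rewrite mulr_sumr.
rewrite exchange_big /=; apply: sumr_le0 => e _.
have := @convex_function_combination _ _ (f e) _ (index_enum I) l
  (fun i => wav (upd p e (u i e))) (wav p) (f_convex e) l0.
rewrite l1 lexx => /(_ isT).
have -> : \sum_i l i *: (wav (upd p e (u i e)) - wav p) = 0.
  under eq_bigr => i _ do rewrite wav_upd addrAC subrr add0r scalerA mulrC -scalerA scalerBr.
  by rewrite -scaler_sumr sumrB -scaler_suml l1 scale1r subrr scaler0.
rewrite addr0 lerDl => le; rewrite -oppr_ge0 -sumrN.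
by under eq_bigr do rewrite -mulrN opprB.
Qed.

(** KKM in the mixture weights: positive gains at all indices of positive weight would contradict
    [gain_combination]. *)
Lemma finite_gain_le0 (W : set 'rV[R]_d) (m : nat)
    (u : 'I_m.+1 -> E -> 'rV[R]_d) :
  convex_set W -> (forall i e, W (u i e)) ->
  exists p, (forall e, W (p e)) /\ forall i, gain (u i) p <= 0.
Proof.
move=> cW Wu.
pose p (x : 'rV[R]_m.+1) e := \sum_j x ord0 j *: u j e.
have pc e : continuous (fun x => p x e).
  apply: (continuous_sum (F := fun j (x : 'rV[R]_m.+1) => x ord0 j *: u j e)) => j x.
  have cx : {for x, continuous (fun y : 'rV[R]_m.+1 => y ord0 j)}.
    exact: coord_continuous.
  exact: (continuousZr_tmp cx).
have [|x [x0 x1]|x [x0 x1] gx] := @simplex_kkm R m (fun i x => gain (u i) (p x)).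
- by move=> i; apply: continuous_gain.
- apply: contrapT => nex.
  have [i0 i00] : exists i, 0 < x ord0 i.
    apply: contrapT => no; have : \sum_i x ord0 i <= 0.
      by apply: sumr_le0 => i _; rewrite leNgt; apply/negP => ?; apply: no; exists i.
    by rewrite x1 ler10.
  have pos i : 0 < x ord0 i -> 0 < gain (u i) (p x).
    by move=> xi; rewrite ltNge; apply/negP => ?; apply: nex; exists i.
  have := gain_combination u x0 x1; rewrite leNgt => /negP; apply.
  rewrite (bigD1 i0)//= ltr_pwDl ?mulr_gt0 ?pos// sumr_ge0// => i _.
  have := x0 i; rewrite le_eqVlt => /orP[/eqP <-|xi]; first by rewrite mul0r.
  by rewrite ltW// mulr_gt0// pos.
exists (p x); split=> // e.
have -> : p x e = u ord0 e + \sum_j x ord0 j *: (u j e - u ord0 e).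
  under [in RHS]eq_bigr do rewrite scalerBr.
  by rewrite sumrB -scaler_suml x1 scale1r addrC subrK.
by apply: convex_set_combination; rewrite ?x1.
Qed.

Lemma average_game_equilibrium (W : set 'rV[R]_d) :
  compact W -> convex_set W -> W !=set0 ->
  exists p, (forall e, W (p e)) /\
    forall e w, W w -> f e (wav p) <= f e (wav (upd p e w)).
Proof.
move=> coW cW [w0 Ww0].
pose WE : set (prod_topology (fun _ : E => 'rV[R]_d)) :=
  [set p | forall e, W (p e)].
have coWE : compact WE by apply: (tychonoff (fun=> coW)).
have [||p [Wp gp]] := @compact_finI _ WE {p : E -> 'rV[R]_d | `[< forall e, W (p e)>]}
  (fun a => [set p | gain (sval a) p <= 0]) coWE.
- move=> a.
  have gc : continuous (gain (sval a) : prod_topology (fun _ : E => 'rV[R]_d) -> R).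
    apply: (@continuous_gain (prod_topology (fun _ : E => 'rV[R]_d)) (sval a) id) => e.
    exact: (@proj_continuous E (fun=> 'rV[R]_d) e).
  by apply: (preimage_closed _ (@closed_le R 0)) => x _; apply: gc.
(* Putting the constant profile [q0] in front makes the finite family nonempty. *)
- move=> s; pose q0 : E -> 'rV[R]_d := fun=> w0.
  have [|p [Wp gp]] := @finite_gain_le0 W (size s)
    (fun i => nth q0 (q0 :: map sval s) i) cW.
    move=> [[|i] /= ilt] e //.
    by rewrite (nth_map (exist _ q0 (asboolT (fun=> Ww0))))//; move: e; apply/asboolP/(valP (nth _ s i)).
  exists p; split=> // a sa.
  have lt : ((index a s).+1 < (size s).+1)%N by rewrite ltnS index_mem.
  have := gp (Ordinal lt); rewrite /= (nth_map a) ?index_mem// nth_index//.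
exists p; split=> // e w Ww.
(* Against the profile where only [e] deviates, the gain reduces to the term of [e]. *)
have WEw : `[< forall e', W (upd p e w e')>].
  by apply/asboolP => e'; rewrite /upd; case: eqP.
have := gp (exist (fun p => `[< forall e, W (p e) >]) _ WEw); rewrite /= /gain (bigD1 e)//= big1 ?addr0; last first.
  by move=> e' /negPf ne; rewrite wav_upd /upd ne subrr scaler0 addr0 subrr.
have -> : upd p e w e = w by rewrite /upd eqxx.
by rewrite subr_le0.
Qed.

Lemma interior_equilibrium_min (W : set 'rV[R]_d) p e (v : 'rV[R]_d) :
  interior W (p e) ->
  (forall w, W w -> f e (wav p) <= f e (wav (upd p e w))) ->
  f e (wav p) <= f e v.
Proof.
move=> iW eqp.
have E0 : #|E|%:R != 0 :> R by rewrite pnatr_eq0 -lt0n; apply/card_gt0P; exists e.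
(* The factor [#|E|] cancels the averaging, so player [e] alone moves the average along the segment
   from [wav p] to [v]. *)
pose path (t : R) := p e + t *: (#|E|%:R *: (v - wav p)).
have pathc : {for 0, continuous path}.
  apply: continuousD; first exact: cst_continuous.
  by apply: continuousZr_tmp; apply: cvg_id.
have W0 : \forall t \near (0 : R), W (path t).
  by apply: pathc; rewrite /path scale0r addr0.
have /nbhs_ballP[r /= r0 rW] := W0.
pose t := Num.min (r / 2) 1.
have t0 : 0 < t by rewrite lt_min divr_gt0 ?ltr01.
have t1 : t <= 1 by rewrite ge_min lexx orbT.
have Wt : W (path t).
  apply: rW; rewrite /ball /= sub0r normrN gtr0_norm//.
  by rewrite gt_min ltr_pdivrMr// ltr_pMr// ltr1n.
have := eqp _ Wt; rewrite wav_upd /path addrAC subrr add0r !scalerA.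
rewrite mulrCA mulVf// mulr1.
have -> : wav p + t *: (v - wav p) = t *: v + (1 - t) *: wav p.
  by rewrite scalerBr scalerBl scale1r addrCA addrA.
(* Convexity and the equilibrium inequality give [t * f e (wav p) <= t * f e v], with [t > 0]. *)
have /convex_functionP/(_ v (wav p) t (ltW t0) t1) := f_convex e.
move=> le1 le2; have := le_trans le2 le1.
by rewrite mulrBl mul1r addrCA lerDl subr_ge0 ler_pM2l.
Qed.
End Nikaido_Isoda.

(** * Convexity of integrals and the ensemble game *)

Lemma convex_Rintegral (R : realType) (d0 : measure_display)
    (T : measurableType d0) (mu : {measure set T -> \bar R}) (V : lmodType R)
    (g : V -> T -> R) :
  (forall x, convex_function setT (fun v => g v x : R^o)) ->
  (forall v, mu.-integrable setT (EFin \o g v)) ->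
  convex_function setT (fun v => (\int[mu]_x g v x : R^o)).
Proof.
move=> cg ig; apply/convex_functionP => u v t t0 t1.
have iZ r w : mu.-integrable setT (EFin \o (fun x => r * g w x)).
  exact: (integrableZl measurableT r (ig w)).
rewrite -!RintegralZl// -RintegralD//.
apply: le_Rintegral => //.
- exact: (integrableD measurableT (iZ _ _) (iZ _ _)).
- by move=> x _; have /convex_functionP := cg x; apply.
Qed.

Unset Implicit Arguments.

Theorem theorem3 (R : realType) (d0 : measure_display) (X : measurableType d0)
  (d : nat) (E : finType) (P : E -> probability (X * R)%type R)
  (loss : R -> R -> R) (Phi : X -> 'rV[R]_d) (W : set 'rV[R]_d) :
  (0 < #|E|)%N ->
  closed W -> bounded_set W -> convex_set W -> interior W !=set0 ->
  (* the loss l(w^t z, y) is convex and continuous in w, for z in Z = Phi(X) *)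
  (forall (x : X) (y : R),
     convex_function setT (fun w : 'rV[R]_d => loss (dotv w (Phi x)) y : R^o)
     /\ continuous (fun w : 'rV[R]_d => loss (dotv w (Phi x)) y)) ->
  (* the risks R^e(v^t Phi) are well defined (finite) for every v in R^d *)
  (forall (e : E) (v : 'rV[R]_d),
     (P e).-integrable setT (fun xy => (loss (dotv v (Phi xy.1)) xy.2)%:E)) ->
  (exists ws : E -> 'rV[R]_d, ensemble_nash P loss Phi W ws) /\
  (forall ws : E -> 'rV[R]_d, ensemble_nash P loss Phi W ws ->
     (forall q, interior W (ws q)) ->
     forall (e : E) (v : 'rV[R]_d),
       (risk (P e) loss (linpred Phi (wav ws))
          <= risk (P e) loss (linpred Phi v))%E).
Proof.
move=> _ clW bW cW [w0 /interior_subset Ww0] closs iloss.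
pose f e (v : 'rV[R]_d) := \int[P e]_xy loss (dotv v (Phi xy.1)) xy.2.
(* Integrability makes the risks finite, which reduces the game to the real costs [f e]. *)
have riskE e v : risk (P e) loss (linpred Phi v) = (f e v)%:E.
  by rewrite /f /Rintegral fineK//; apply: integrable_fin_num => //; exact: iloss.
have f_convex e : convex_function setT (f e : 'rV[R]_d -> R^o).
  apply: (convex_Rintegral (g := fun v (xy : X * R) =>
    loss (dotv v (Phi xy.1)) xy.2)) => [xy|v]; last exact: iloss.
  by have [] := closs xy.1 xy.2.
have nashP ws : ensemble_nash P loss Phi W ws <->
    (forall e, W (ws e)) /\
    forall e w, W w -> f e (wav ws) <= f e (wav (upd ws e w)).
  split=> -[Wws nash]; split=> // e w Ww; have := nash e w Ww.
    by rewrite !riskE -!EFinN lte_fin ltrN2 => /negP; rewrite -leNgt.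
  by rewrite !riskE -!EFinN lte_fin ltrN2 leNgt => /negP.
split.
  have [|ws /nashP] := average_game_equilibrium f_convex
    (bounded_closed_compact bW clW) cW; last by exists ws.
  by exists w0.
move=> ws /nashP[_ nash] iWs e v; rewrite !riskE lee_fin.
exact: (interior_equilibrium_min f_convex v (iWs e) (nash e)).
Qed.
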